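(* Let $F$ be a field and let $L(\Gamma_1)$ be the Leavitt path algebra over $F$ of the graph $\Gamma_1$ with two vertices $v_1,v_2$ and two edges: a loop $c$ at $v_1$ and an edge $e$ from $v_1$ to $v_2$. Let $I_0$ be the two-sided ideal of $L(\Gamma_1)$ generated by $v_2$, so that $I_0\cong M_\infty(F)$ and $L(\Gamma_1)/I_0\cong F[t^{-1},t]$. Then the resulting short exact sequence $$(0)\to M_\infty(F)\to L(\Gamma_1)\to F[t^{-1},t]\to (0)$$ does not split; that is, there is no (not necessarily unital) $F$-algebra homomorphism $\sigma:F[t^{-1},t]\to L(\Gamma_1)$ whose composition with the projection $L(\Gamma_1)\to F[t^{-1},t]$ is the identity.
   Context: The Leavitt path algebra $L(\Gamma)$ over $F$ of a finite directed graph $\Gamma=(V,E)$ with source and range maps $s,r:E\to V$ is the associative $F$-algebra presented by generators $\{v : v\in V\}\cup\{e,e^* : e\in E\}$ and relations: (i) $v_iv_j=\delta_{v_i,v_j}v_i$ for all $v_i,v_j\in V$; (ii) $s(e)e=e\,r(e)=e$ and $r(e)e^*=e^*s(e)=e^*$ for all $e\in E$; (iii) $e^*f=\delta_{e,f}\,r(e)$ for all $e,f\in E$; (iv) $v=\sum_{s(e)=v}ee^*$ for every vertex $v$ with $s^{-1}(v)\neq\emptyset$. $M_\infty(F)$ is the algebra of infinite $\mathbb{N}\times\mathbb{N}$ matrices over $F$ with only finitely many nonzero entries, and $F[t^{-1},t]$ is the Laurent polynomial algebra. The isomorphism $L(\Gamma_1)/I_0\cong F[t^{-1},t]$ sends the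 class of $c$ to $t$ and the class of $c^*$ to $t^{-1}$. The algebra $L(\Gamma_1)$ is called the algebraic Toeplitz algebra; it is isomorphic to the algebra $\langle x,y\mid xy=1\rangle$. *)

(* Defs.v *)
From HB Require Import structures.
From mathcomp Require Import all_boot all_algebra finmap boolp.
From mathcomp Require Import monalg.

Set Implicit Arguments.
Unset Strict Implicit.
Unset Printing Implicit Defensive.

Import GRing.Theory.
Local Open Scope ring_scope.
Local Open Scope quotient_scope.

Reserved Notation "x ** y" (at level 40, left associativity).

(* No unit is required: MathComp's algType is unital, which would exclude the
   finitary infinite matrices and force algebra morphisms to preserve 1. *)

HB.mixin Record Lmodule_isAssocAlgebra (F : fieldType) A of GRing.Lmodule F A := {
  amul : A -> A -> A;
  amulA : associative amul;
  amulDl : left_distributive amul +%R;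
  amulDr : right_distributive amul +%R;
  amulZl : forall (a : F) x y, amul (a *: x) y = a *: amul x y;
  amulZr : forall (a : F) x y, amul x (a *: y) = a *: amul x y
}.

#[short(type="assocAlgType")]
HB.structure Definition AssocAlgebra (F : fieldType) :=
  { A of GRing.Lmodule F A & Lmodule_isAssocAlgebra F A }.

Notation "x ** y" := (amul x y) : ring_scope.

Section AlgebraNotions.
Context (F : fieldType) (A B : assocAlgType F).

Definition alg_hom (f : A -> B) : Prop :=
  linear f /\ {morph f : x y / x ** y}.

Record two_sided_ideal (I : A -> Prop) : Prop := TwoSidedIdeal {
  ideal0 : I 0;
  idealP : forall (a : F) x y, I x -> I y -> I (a *: x + y);
  idealMl : forall a x, I x -> I (a ** x);
  idealMr : forall a x, I x -> I (x ** a)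
}.

Definition ideal_gen (S : A -> Prop) (x : A) : Prop :=
  forall I, two_sided_ideal I -> (forall s, S s -> I s) -> I x.

End AlgebraNotions.

(* 0 -> A --iota--> B --pi--> C -> 0 *)
Definition short_exact (F : fieldType) (A B C : assocAlgType F)
    (iota : A -> B) (pi : B -> C) : Prop :=
  [/\ alg_hom iota, alg_hom pi, injective iota,
      (forall c, exists b, pi b = c)
    & (forall b, pi b = 0 <-> exists a, iota a = b)].

Definition splits (F : fieldType) (B C : assocAlgType F) (pi : B -> C) : Prop :=
  exists2 sigma : C -> B, alg_hom sigma & cancel sigma pi.

(* The algebra presented by generators X and relations R is the quotient of the
   terms over X by the least congruence containing R and the axioms of
   associative, not necessarily unital, algebras. *)

Inductive term (F : fieldType) (X : Type) : Type :=
| tgen of X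
| tzero
| tadd of term F X & term F X
| tscale of F & term F X
| tmul of term F X & term F X.

Arguments tgen {F X}.
Arguments tzero {F X}.

HB.instance Definition _ (F : fieldType) X := gen_eqMixin (term F X).
HB.instance Definition _ (F : fieldType) X := gen_choiceMixin (term F X).

Section Presentation.
Context (F : fieldType) (X : Type) (R : term F X -> term F X -> Prop).
Local Notation T := (term F X).
Implicit Types (s t u : T) (a b : F).

Inductive pcong : T -> T -> Prop :=
| pcong_rel s t : R s t -> pcong s t
| pcong_refl s : pcong s s
| pcong_sym s t : pcong s t -> pcong t s
| pcong_trans s t u : pcong s t -> pcong t u -> pcong s u
| pcong_add s s' t t' :
    pcong s s' -> pcong t t' -> pcong (tadd s t) (tadd s' t')
| pcong_scale a s s' : pcong s s' -> pcong (tscale a s) (tscale a s')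
| pcong_mul s s' t t' :
    pcong s s' -> pcong t t' -> pcong (tmul s t) (tmul s' t')
| pcong_addA s t u : pcong (tadd s (tadd t u)) (tadd (tadd s t) u)
| pcong_addC s t : pcong (tadd s t) (tadd t s)
| pcong_add0 s : pcong (tadd tzero s) s
| pcong_addN s : pcong (tadd (tscale (-1) s) s) tzero
| pcong_scaleA a b s : pcong (tscale a (tscale b s)) (tscale (a * b) s)
| pcong_scale1 s : pcong (tscale 1 s) s
| pcong_scaleDr a s t :
    pcong (tscale a (tadd s t)) (tadd (tscale a s) (tscale a t))
| pcong_scaleDl a b s :
    pcong (tscale (a + b) s) (tadd (tscale a s) (tscale b s))
| pcong_mulA s t u : pcong (tmul s (tmul t u)) (tmul (tmul s t) u)
| pcong_mulDl s t u : pcong (tmul (tadd s t) u) (tadd (tmul s u) (tmul t u))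
| pcong_mulDr s t u : pcong (tmul s (tadd t u)) (tadd (tmul s t) (tmul s u))
| pcong_mulZl a s t : pcong (tmul (tscale a s) t) (tscale a (tmul s t))
| pcong_mulZr a s t : pcong (tmul s (tscale a t)) (tscale a (tmul s t)).

Let pcongb s t := `[< pcong s t >].

Let pcongb_refl : reflexive pcongb.
Proof. by move=> s; apply/asboolP/pcong_refl. Qed.

Let pcongb_sym : symmetric pcongb.
Proof. by move=> s t; apply/asboolP/asboolP; apply: pcong_sym. Qed.

Let pcongb_trans : transitive pcongb.
Proof.
by move=> t s u /asboolP st /asboolP tu; apply/asboolP/(pcong_trans st tu).
Qed.

Definition pcong_equiv : equiv_rel T :=
  EquivRel pcongb pcongb_refl pcongb_sym pcongb_trans.

Definition pres_alg := {eq_quot pcong_equiv}.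
HB.instance Definition _ := Choice.on pres_alg.

Definition pclass (t : T) : pres_alg := \pi_({eq_quot pcong_equiv}) t.
Definition prepr (x : pres_alg) : T := repr (x : {eq_quot pcong_equiv}).

Definition pres_gen (x : X) : pres_alg := pclass (tgen x).

Lemma preprK x : pclass (prepr x) = x.
Proof. exact: reprK. Qed.

Lemma pclassP s t : pclass s = pclass t <-> pcong s t.
Proof.
split=> [/(@eqmodP _ pcong_equiv) /asboolP //|st].
by apply/(@eqmodP _ pcong_equiv)/asboolP.
Qed.

Lemma pclassK t : pcong (prepr (pclass t)) t.
Proof. by apply/pclassP; rewrite preprK. Qed.

Definition pzero : pres_alg := pclass tzero.
Definition padd (x y : pres_alg) := pclass (tadd (prepr x) (prepr y)).
Definition popp (x : pres_alg) := pclass (tscale (-1) (prepr x)).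
Definition pscale a (x : pres_alg) := pclass (tscale a (prepr x)).
Definition pmul (x y : pres_alg) := pclass (tmul (prepr x) (prepr y)).

Lemma paddE s t : padd (pclass s) (pclass t) = pclass (tadd s t).
Proof. by apply/pclassP; apply: pcong_add; apply: pclassK. Qed.

Lemma pscaleE a s : pscale a (pclass s) = pclass (tscale a s).
Proof. by apply/pclassP; apply: pcong_scale; apply: pclassK. Qed.

Lemma pmulE s t : pmul (pclass s) (pclass t) = pclass (tmul s t).
Proof. by apply/pclassP; apply: pcong_mul; apply: pclassK. Qed.

Lemma paddA : associative padd.
Proof.
move=> x y z; rewrite -(preprK x) -(preprK y) -(preprK z) !paddE.
exact/pclassP/pcong_addA.
Qed.

Lemma paddC : commutative padd.
Proof.
move=> x y; rewrite -(preprK x) -(preprK y) !paddE.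
exact/pclassP/pcong_addC.
Qed.

Lemma padd0 : left_id pzero padd.
Proof. by move=> x; rewrite -(preprK x) paddE; apply/pclassP/pcong_add0. Qed.

Lemma paddN : left_inverse pzero popp padd.
Proof.
by move=> x; rewrite -[X in padd _ X]preprK paddE; apply/pclassP/pcong_addN.
Qed.

HB.instance Definition _ := GRing.isZmodule.Build pres_alg paddA paddC padd0 paddN.

Lemma pscaleA a b x : pscale a (pscale b x) = pscale (a * b) x.
Proof.
by rewrite -(preprK x) !pscaleE; apply/pclassP/pcong_scaleA.
Qed.

Lemma pscale1 : left_id 1 pscale.
Proof. by move=> x; rewrite -(preprK x) pscaleE; apply/pclassP/pcong_scale1. Qed.

Lemma pscaleDr : right_distributive pscale +%R.
Proof.
move=> a x y; rewrite -(preprK x) -(preprK y).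
by rewrite -[_ + _]/(padd _ _) -[RHS]/(padd _ _) !(paddE, pscaleE);
  apply/pclassP/pcong_scaleDr.
Qed.

Lemma pscaleDl x : {morph pscale^~ x : a b / a + b}.
Proof.
move=> a b; rewrite -(preprK x) -[RHS]/(padd _ _) !(paddE, pscaleE).
exact/pclassP/pcong_scaleDl.
Qed.

HB.instance Definition _ :=
  GRing.Zmodule_isLmodule.Build F pres_alg pscaleA pscale1 pscaleDr pscaleDl.

Lemma pmulA : associative pmul.
Proof.
move=> x y z; rewrite -(preprK x) -(preprK y) -(preprK z) !pmulE.
exact/pclassP/pcong_mulA.
Qed.

Lemma pmulDl : left_distributive pmul +%R.
Proof.
move=> x y z; rewrite -(preprK x) -(preprK y) -(preprK z).
rewrite -[_ + _]/(padd _ _) -[RHS]/(padd _ _) !(paddE, pmulE).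
exact/pclassP/pcong_mulDl.
Qed.

Lemma pmulDr : right_distributive pmul +%R.
Proof.
move=> x y z; rewrite -(preprK x) -(preprK y) -(preprK z).
rewrite -[_ + _]/(padd _ _) -[RHS]/(padd _ _) !(paddE, pmulE).
exact/pclassP/pcong_mulDr.
Qed.

Lemma pmulZl a x y : pmul (a *: x) y = a *: pmul x y.
Proof.
rewrite -(preprK x) -(preprK y) -![_ *: _]/(pscale _ _) !(pscaleE, pmulE).
exact/pclassP/pcong_mulZl.
Qed.

Lemma pmulZr a x y : pmul x (a *: y) = a *: pmul x y.
Proof.
rewrite -(preprK x) -(preprK y) -![_ *: _]/(pscale _ _) !(pscaleE, pmulE).
exact/pclassP/pcong_mulZr.
Qed.

HB.instance Definition _ := Lmodule_isAssocAlgebra.Build F pres_alg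
  pmulA pmulDl pmulDr pmulZl pmulZr.

End Presentation.

Section UniversalProperty.
Context (F : fieldType) (X : Type) (R : term F X -> term F X -> Prop).
Context (A : assocAlgType F) (g : X -> A).

Fixpoint teval (t : term F X) : A :=
  match t with
  | tgen x => g x
  | tzero => 0
  | tadd s t => teval s + teval t
  | tscale a t => a *: teval t
  | tmul s t => teval s ** teval t
  end.

Definition pres_lift (x : pres_alg R) : A := teval (prepr x).

Hypothesis gR : forall s t, R s t -> teval s = teval t.

Lemma teval_pcong s t : pcong R s t -> teval s = teval t.
Proof.
elim=> {s t}; first exact: gR.
all: move=> * /=; rewrite ?addrA ?add0r ?scaleN1r ?addNr ?scalerA ?scale1r
  ?scalerDr ?scalerDl ?amulA ?amulDl ?amulDr ?amulZl ?amulZr //; try congruence.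
exact: addrC.
Qed.

Lemma pres_liftE t : pres_lift (pclass R t) = teval t.
Proof. exact/teval_pcong/pclassK. Qed.

Lemma pres_lift_gen x : pres_lift (pres_gen R x) = g x.
Proof. by rewrite pres_liftE. Qed.

Lemma pres_lift_hom : alg_hom pres_lift.
Proof.
split=> [a x y|x y]; rewrite -(preprK x) -(preprK y).
  by rewrite -[_ *: _]/(pscale _ _) -[_ + _]/(padd _ _) pscaleE paddE !pres_liftE.
by rewrite -[_ ** _]/(pmul _ _) pmulE !pres_liftE.
Qed.

Lemma pres_lift_unique (f : pres_alg R -> A) :
  alg_hom f -> (forall x, f (pres_gen R x) = g x) -> f =1 pres_lift.
Proof.
case=> flin fM fg x; rewrite -(preprK x) pres_liftE.
have f0 : f 0 = 0.
  by have := flin (-1) 0 0; rewrite scaler0 addr0 scaleN1r addNr.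
elim: (prepr x) => /= [y||s IHs t IHt|a s IHs|s IHs t IHt].
- exact: fg.
- exact: f0.
- rewrite -IHs -IHt -paddE -[padd _ _]/(pclass R s + pclass R t).
  by rewrite -{1}[pclass R s]scale1r flin scale1r.
- rewrite -IHs -pscaleE -[pscale _ _]/(a *: pclass R s).
  by rewrite -[a *: pclass R s]addr0 flin f0 addr0.
- by rewrite -IHs -IHt -pmulE -fM.
Qed.

End UniversalProperty.

Record digraph := Digraph {
  vertex : finType;
  edge : finType;
  src : edge -> vertex;
  rng : edge -> vertex
}.

Variant lpa_gen (G : digraph) : Type :=
| Vert of vertex G
| Edge of edge G
| Ghost of edge G.

Arguments Vert {G}.
Arguments Edge {G}.
Arguments Ghost {G}.

Section Leavitt.
Context (F : fieldType) (G : digraph).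

Local Notation tv v := (tgen (Vert v) : term F (lpa_gen G)).
Local Notation te e := (tgen (Edge e) : term F (lpa_gen G)).
Local Notation tg e := (tgen (Ghost e) : term F (lpa_gen G)).

Inductive lpa_rel : term F (lpa_gen G) -> term F (lpa_gen G) -> Prop :=
| lpa_vertex v w : lpa_rel (tmul (tv v) (tv w)) (if v == w then tv v else tzero)
| lpa_src_edge e : lpa_rel (tmul (tv (src e)) (te e)) (te e)
| lpa_edge_rng e : lpa_rel (tmul (te e) (tv (rng e))) (te e)
| lpa_rng_ghost e : lpa_rel (tmul (tv (rng e)) (tg e)) (tg e)
| lpa_ghost_src e : lpa_rel (tmul (tg e) (tv (src e))) (tg e)
| lpa_ghost_edge e f :
    lpa_rel (tmul (tg e) (te f)) (if e == f then tv (rng e) else tzero)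
| lpa_CK v : (exists e, src e = v) ->
    lpa_rel (tv v)
      (\big[@tadd F (lpa_gen G)/tzero]_(e : edge G | src e == v)
         tmul (te e) (tg e)).

Definition leavitt := pres_alg lpa_rel.
HB.instance Definition _ := AssocAlgebra.on leavitt.

Definition lpa_vert (v : vertex G) : leavitt := pres_gen lpa_rel (Vert v).
Definition lpa_edge (e : edge G) : leavitt := pres_gen lpa_rel (Edge e).
Definition lpa_ghost (e : edge G) : leavitt := pres_gen lpa_rel (Ghost e).

End Leavitt.

(* The graph of the algebraic Toeplitz algebra. Vertices: false is v_1, true is
   v_2. Edges: false is the loop c at v_1, true is the edge e : v_1 -> v_2. *)
Definition toeplitz_graph : digraph :=
  @Digraph bool bool (fun _ => false) (fun e => e).

Section Toeplitz.
Context (F : fieldType).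

Definition toeplitz := leavitt F toeplitz_graph.
HB.instance Definition _ := AssocAlgebra.on toeplitz.

Definition toep_v1 : toeplitz := @lpa_vert F toeplitz_graph false.
Definition toep_v2 : toeplitz := @lpa_vert F toeplitz_graph true.
Definition toep_c : toeplitz := @lpa_edge F toeplitz_graph false.
Definition toep_e : toeplitz := @lpa_edge F toeplitz_graph true.
Definition toep_c_star : toeplitz := @lpa_ghost F toeplitz_graph false.
Definition toep_e_star : toeplitz := @lpa_ghost F toeplitz_graph true.

Definition toep_I0 : toeplitz -> Prop := ideal_gen (fun x => x = toep_v2).

End Toeplitz.

(* sc_mul m is the bilinear product on the free module {malg F[K]} such that
   << k >> << l >> = m k l. *)

Section StructureConstants.
Context (F : fieldType) (K : choiceType).
Implicit Types (f g : {malg F[K]}) (m : K -> K -> {malg F[K]}).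

Definition lin_ext (h : K -> {malg F[K]}) f : {malg F[K]} :=
  \sum_(k <- msupp f) f@_k *: h k.

Definition sc_mul m f g : {malg F[K]} := lin_ext (fun k => lin_ext (m k) g) f.

Lemma lin_extw h f (d : {fset K}) : (msupp f `<=` d)%fset ->
  lin_ext h f = \sum_(k <- d) f@_k *: h k.
Proof.
move=> fd; rewrite /lin_ext (big_fset_incl _ fd) // => k _ /mcoeff_outdom ->.
by rewrite scale0r.
Qed.

Lemma lin_ext_linear h : linear (lin_ext h).
Proof.
move=> a f g; set d := (msupp f `|` msupp g)%fset.
have fd : (msupp f `<=` d)%fset by apply: fsubsetUl.
have gd : (msupp g `<=` d)%fset by apply: fsubsetUr.
have afd : (msupp (a *: f + g) `<=` d)%fset.
  apply: (fsubset_trans (msuppD_le _ _)); rewrite fsubUset gd andbT.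
  exact: (fsubset_trans (msuppZ_le _ _)).
rewrite (lin_extw h fd) (lin_extw h gd) (lin_extw h afd) scaler_sumr -big_split.
by apply: eq_bigr => k _; rewrite /= mcoeffD mcoeffZ scalerDl scalerA.
Qed.

HB.instance Definition _ h :=
  GRing.isLinear.Build F {malg F[K]} {malg F[K]} _ (lin_ext h) (lin_ext_linear h).

Lemma lin_extU h k : lin_ext h << k >> = h k.
Proof.
by rewrite (lin_extw h msuppU_le) big_seq_fset1 mcoeffUU scale1r.
Qed.

Lemma eq_lin_ext h h' f : h =1 h' -> lin_ext h f = lin_ext h' f.
Proof. by move=> hh; apply: eq_bigr => k _; rewrite hh. Qed.

Lemma lin_ext_comp h h' f : lin_ext h (lin_ext h' f) = lin_ext (lin_ext h \o h') f.
Proof.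
by rewrite {2}/lin_ext linear_sum; apply: eq_bigr => k _; rewrite linearZ.
Qed.

Lemma lin_ext_exchange (h : K -> K -> {malg F[K]}) f g :
  lin_ext (fun k => lin_ext (h k) g) f = lin_ext (fun l => lin_ext (h^~ l) f) g.
Proof.
rewrite /lin_ext; under eq_bigr do rewrite scaler_sumr.
rewrite exchange_big; apply: eq_bigr => l _; rewrite scaler_sumr.
by apply: eq_bigr => k _; rewrite !scalerA mulrC.
Qed.

Lemma sc_mulDl m : left_distributive (sc_mul m) +%R.
Proof. by move=> f g n; rewrite /sc_mul linearD. Qed.

Lemma sc_mulZl m a f g : sc_mul m (a *: f) g = a *: sc_mul m f g.
Proof. by rewrite /sc_mul linearZ. Qed.

Lemma sc_mulDr m : right_distributive (sc_mul m) +%R.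
Proof.
by move=> f g n; rewrite /sc_mul !(lin_ext_exchange m f) linearD.
Qed.

Lemma sc_mulZr m a f g : sc_mul m f (a *: g) = a *: sc_mul m f g.
Proof. by rewrite /sc_mul !(lin_ext_exchange m f) linearZ. Qed.

Lemma sc_mulUU m k l : sc_mul m << k >> << l >> = m k l.
Proof. by rewrite /sc_mul !lin_extU. Qed.

Lemma sc_mulA m :
  (forall k l n, sc_mul m (m k l) << n >> = sc_mul m << k >> (m l n)) ->
  associative (sc_mul m).
Proof.
move=> mA f g n; rewrite /sc_mul !lin_ext_comp; apply: eq_lin_ext => k /=.
rewrite !lin_ext_comp; apply: eq_lin_ext => l /=.
rewrite lin_ext_comp [RHS]lin_ext_exchange; apply: eq_lin_ext => p /=.
have := mA k l p; rewrite /sc_mul lin_extU => <-.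
by apply: eq_lin_ext => q; rewrite lin_extU.
Qed.

End StructureConstants.

(* M_oo(F): an element A is an N x N matrix with finite support, with entry
   A@_(i, j) in row i and column j; << (i, j) >> is the matrix unit E_ij. *)
Section InfiniteMatrices.
Context (F : fieldType).

Definition M_inf := {malg F[(nat * nat)%type]}.
HB.instance Definition _ := GRing.Lmodule.on M_inf.

Definition unit_mul (p q : nat * nat) : M_inf :=
  if p.2 == q.1 then << (p.1, q.2) >> else 0.

Lemma unit_mulA p q r :
  sc_mul unit_mul (unit_mul p q) << r >> = sc_mul unit_mul << p >> (unit_mul q r).
Proof.
case: p q r => [i j] [k l] [m n]; rewrite {2 4}/unit_mul /=.
have s0 f : sc_mul unit_mul 0 f = 0 by rewrite /sc_mul linear0.
have s0r f : sc_mul unit_mul f 0 = 0 by rewrite /sc_mul lin_ext_exchange linear0.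
case: (j =P k) => jk; case: (l =P m) => lm; rewrite ?s0 ?s0r ?sc_mulUU //.
- by rewrite /unit_mul /= lm jk !eqxx.
- by rewrite /unit_mul /=; move/eqP/negbTE: lm => ->.
- by rewrite /unit_mul /=; move/eqP/negbTE: jk => ->.
Qed.

HB.instance Definition _ := Lmodule_isAssocAlgebra.Build F M_inf
  (sc_mulA unit_mulA) (@sc_mulDl _ _ unit_mul) (@sc_mulDr _ _ unit_mul)
  (@sc_mulZl _ _ unit_mul) (@sc_mulZr _ _ unit_mul).

End InfiniteMatrices.

(* F[t^-1, t]: << i >> is the monomial t^i, i : int. *)
Section LaurentPolynomials.
Context (F : fieldType).

Definition laurent := {malg F[int]}.
HB.instance Definition _ := GRing.Lmodule.on laurent.

Definition monomial_mul (i j : int) : laurent := << (i + j)%R >>.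

Lemma monomial_mulA i j k :
  sc_mul monomial_mul (monomial_mul i j) << k >> =
  sc_mul monomial_mul << i >> (monomial_mul j k).
Proof. by rewrite !sc_mulUU /monomial_mul addrA. Qed.

HB.instance Definition _ := Lmodule_isAssocAlgebra.Build F laurent
  (sc_mulA monomial_mulA) (@sc_mulDl _ _ monomial_mul)
  (@sc_mulDr _ _ monomial_mul) (@sc_mulZl _ _ monomial_mul)
  (@sc_mulZr _ _ monomial_mul).

Definition laurent_t : laurent := << 1%:Z >>.
Definition laurent_tV : laurent := << (- 1%:Z)%R >>.

End LaurentPolynomials.

(* The image of iota, hence the kernel of pi, is I_0, and the isomorphism
   L / I_0 -> F[t^-1, t] induced by pi sends c to t and c^* to t^-1. *)
Definition toeplitz_extension (F : fieldType)
    (iota : M_inf F -> toeplitz F) (pi : toeplitz F -> laurent F) : Prop :=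
  [/\ short_exact iota pi,
      (forall x, toep_I0 x <-> exists a, iota a = x),
      pi (toep_c F) = laurent_t F
    & pi (toep_c_star F) = laurent_tV F].

(* Main.v *)
Require Import Defs.
From HB Require Import structures.
From mathcomp Require Import all_boot all_algebra.
From mathcomp Require Import finmap monalg zify.

Set Implicit Arguments.
Unset Strict Implicit.
Unset Printing Implicit Defensive.

Import GRing.Theory.
Local Open Scope ring_scope.

(** Put S = c + e and S' = c* + e*. The relations of the graph say exactly that
    o = v1 + v2 is a unit, that S' S = o, and that S S' = v1, so that
    v2 = o - S S' measures the failure of S to be invertible; moreover S and S'
    generate the algebra. Hence the Toeplitz algebra is the universal algebra
    with a unit and a one-sided inverse ([toeplitz_lift], [toeplitz_ind]).

    Existence. The elements S^i v2 S'^j multiply as matrix units, which gives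
    iota ([matrix_map_hom]). It is injective as soon as v2 is nonzero
    ([matrix_map_inj]), and v2 is nonzero because its image in the algebra of
    the bicyclic monoid is ([toep_v2_neq0]). The range of iota is an ideal
    containing v2, hence is I_0. Sending S to t and S' to t^-1 defines pi. To
    see that ker pi is contained in I_0, let s be the linear map with
    s(t^n) = S^n and s(t^-n) = S'^n. Modulo I_0 one has z s(f) = s(pi(z) f)
    for all z ([laurent_section_act]): it suffices to check generators z and
    monomials f. Taking f = 1 gives z = s(pi(z)) modulo I_0.

    No splitting. This is a Fredholm index argument. If sigma splits pi, then
    sigma(t) + (o - sigma(1)) is invertible, with inverse
    sigma(t^-1) + (o - sigma(1)), and pi sends it to t = pi(S), so it equals
    S + iota(f) for some finite matrix f. But S acts on row vectors by deleting
    the first coordinate, and f only involves finitely many columns, say n.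
    So S + f maps the row vectors of length n + 1 to those of length n, and
    kills a nonzero one ([shift_perturbation_annihilated]). *)

(** * Nonunital algebras and their presentations *)

Section AlgebraBasics.
Context (F : fieldType) (A B : assocAlgType F).
Implicit Types (x y z : A) (f : A -> B).

Lemma amul0l x : 0 ** x = 0.
Proof. by have := amulZl 0 x x; rewrite !scale0r. Qed.

Lemma amul0r x : x ** 0 = 0.
Proof. by have := amulZr 0 x x; rewrite !scale0r. Qed.

Lemma amulBl x y z : (x - y) ** z = x ** z - y ** z.
Proof. by rewrite -scaleN1r amulDl amulZl scaleN1r. Qed.

Lemma amulBr x y z : x ** (y - z) = x ** y - x ** z.
Proof. by rewrite -scaleN1r amulDr amulZr scaleN1r. Qed.

Lemma amul_suml I (r : seq I) (P : pred I) (g : I -> A) z :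
  (\sum_(i <- r | P i) g i) ** z = \sum_(i <- r | P i) g i ** z.
Proof.
apply: (big_morph (fun x => x ** z)); last exact: amul0l.
by move=> x y; apply: amulDl.
Qed.

Lemma alg_homD f : alg_hom f -> {morph f : x y / x + y}.
Proof. by case=> flin _ x y; have := flin 1 x y; rewrite !scale1r. Qed.

Lemma alg_homB f : alg_hom f -> {morph f : x y / x - y}.
Proof.
by case=> flin _ x y; rewrite addrC -scaleN1r flin scaleN1r addrC.
Qed.

Lemma alg_hom0 f : alg_hom f -> f 0 = 0.
Proof. by move=> fh; rewrite -(subrr 0) (alg_homB fh) subrr. Qed.

Lemma alg_homZ f a x : alg_hom f -> f (a *: x) = a *: f x.
Proof.
by move=> fh; have := fh.1 a x 0; rewrite (alg_hom0 fh) !addr0.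
Qed.

Lemma alg_hom_sum f I (r : seq I) (P : pred I) (g : I -> A) :
  alg_hom f -> f (\sum_(i <- r | P i) g i) = \sum_(i <- r | P i) f (g i).
Proof. by move=> fh; apply: big_morph; [apply: alg_homD|apply: alg_hom0]. Qed.

End AlgebraBasics.

Section PresentationInduction.
Context (F : fieldType) (X : Type) (R : term F X -> term F X -> Prop).

Lemma pres_ind (P : pres_alg R -> Prop) :
    (forall x, P (pres_gen R x)) -> P 0 ->
    (forall a x y, P x -> P y -> P (a *: x + y)) ->
    (forall x y, P x -> P y -> P (x ** y)) ->
  forall x, P x.
Proof.
move=> Pgen P0 Plin Pmul x; rewrite -(preprK x).
elim: (prepr x) => {x} [x||s Ps t Pt|a s Ps|s Ps t Pt].
- exact: Pgen.
- exact: P0.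
- by rewrite -paddE -[pclass R s]scale1r; apply: Plin.
- by rewrite -pscaleE -[pscale _ _]addr0; apply: Plin.
- by rewrite -pmulE; apply: Pmul.
Qed.

End PresentationInduction.

Section LeavittRelations.
Context (F : fieldType) (G : digraph).
Local Notation V := (@lpa_vert F G).
Local Notation E := (@lpa_edge F G).
Local Notation E' := (@lpa_ghost F G).
Implicit Types (v w : vertex G) (e f : edge G).

Let pclassM s t :
  pclass (@lpa_rel F G) s ** pclass _ t = pclass _ (tmul s t) :> leavitt F G.
Proof. exact: pmulE. Qed.

Let pclass_rel s t : @lpa_rel F G s t -> pclass (@lpa_rel F G) s = pclass _ t.
Proof. by move=> st; apply/pclassP/pcong_rel. Qed.

Lemma lpa_vertM v w : V v ** V w = if v == w then V v else 0.
Proof. by rewrite pclassM (pclass_rel (lpa_vertex _ v w)); case: eqP. Qed.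

Lemma lpa_src_edgeE e : V (src e) ** E e = E e.
Proof. by rewrite pclassM (pclass_rel (lpa_src_edge F e)). Qed.

Lemma lpa_edge_rngE e : E e ** V (rng e) = E e.
Proof. by rewrite pclassM (pclass_rel (lpa_edge_rng F e)). Qed.

Lemma lpa_rng_ghostE e : V (rng e) ** E' e = E' e.
Proof. by rewrite pclassM (pclass_rel (lpa_rng_ghost F e)). Qed.

Lemma lpa_ghost_srcE e : E' e ** V (src e) = E' e.
Proof. by rewrite pclassM (pclass_rel (lpa_ghost_src F e)). Qed.

Lemma lpa_ghost_edgeE e f : E' e ** E f = if e == f then V (rng e) else 0.
Proof. by rewrite pclassM (pclass_rel (lpa_ghost_edge _ e f)); case: eqP. Qed.

Lemma lpa_CKE v : (exists e, src e = v) ->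
  V v = \sum_(e : edge G | src e == v) E e ** E' e.
Proof.
move=> vsrc; rewrite /lpa_vert /pres_gen (pclass_rel (lpa_CK F vsrc)).
rewrite (big_morph (pclass (@lpa_rel F G) : _ -> leavitt F G)
  (id1 := 0) (op1 := +%R)) //; last by move=> s t; rewrite -paddE.
by apply: eq_bigr => e _; rewrite -pclassM.
Qed.

End LeavittRelations.

(** * Free modules *)

Section LinearExtension.
Context (F : fieldType) (K : choiceType) (V : lmodType F).
Implicit Types (f g : {malg F[K]}) (h : K -> V).

Lemma malg_ind (P : {malg F[K]} -> Prop) :
    P 0 -> (forall a f g, P f -> P g -> P (a *: f + g)) ->
    (forall k, P << k >>) ->
  forall f, P f.
Proof.
move=> P0 Plin PU f; rewrite (monalgE f).
apply: (big_ind P) => // [g g' Pg Pg'|k _].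
  by rewrite -[g]scale1r; apply: Plin.
suff -> : << f@_k *g k >> = f@_k *: << k >> + 0 :> {malg F[K]}.
  exact: Plin.
by apply/malgP => l; rewrite addr0 mcoeffZ !mcoeffU mulrnAr mulr1.
Qed.

(** [lin_ext] with values in an arbitrary module. *)
Definition mlift h f : V := \sum_(k <- msupp f) f@_k *: h k.

Lemma mliftw h f (d : {fset K}) : (msupp f `<=` d)%fset ->
  mlift h f = \sum_(k <- d) f@_k *: h k.
Proof.
move=> fd; rewrite /mlift (big_fset_incl _ fd) // => k _ /mcoeff_outdom ->.
by rewrite scale0r.
Qed.

Lemma mlift_linear h : linear (mlift h).
Proof.
move=> a f g; set d := (msupp f `|` msupp g)%fset.
have fd : (msupp f `<=` d)%fset by apply: fsubsetUl.
have gd : (msupp g `<=` d)%fset by apply: fsubsetUr.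
have afd : (msupp (a *: f + g) `<=` d)%fset.
  apply: (fsubset_trans (msuppD_le _ _)); rewrite fsubUset gd andbT.
  exact: (fsubset_trans (msuppZ_le _ _)).
rewrite (mliftw h fd) (mliftw h gd) (mliftw h afd) scaler_sumr -big_split.
by apply: eq_bigr => k _; rewrite /= mcoeffD mcoeffZ scalerDl scalerA.
Qed.

HB.instance Definition _ h :=
  GRing.isLinear.Build F {malg F[K]} V _ (mlift h) (mlift_linear h).

Lemma mliftU h k : mlift h << k >> = h k.
Proof.
by rewrite (mliftw h msuppU_le) big_seq_fset1 mcoeffUU scale1r.
Qed.

End LinearExtension.

(** * One-sided inverses *)

Section OneSidedInverse.
Context (F : fieldType) (A : assocAlgType F).
Implicit Types (o x y z : A) (i j k l : nat).

(** The element [o] is a unit for [x] and [y] only: the ambient algebra may be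
    larger, as for the values of a nonunital morphism. *)
Record toeplitz_triple o x y : Prop := ToeplitzTriple {
  tt_oo : o ** o = o;
  tt_ox : o ** x = x;
  tt_xo : x ** o = x;
  tt_oy : o ** y = y;
  tt_yo : y ** o = y;
  tt_xy : x ** y = o
}.

Definition apow o x n : A := iter n (amul x) o.

Variables (o x y : A).
Hypothesis oxy : toeplitz_triple o x y.
Local Notation d := (o - y ** x).
Local Notation X n := (apow o x n).
Local Notation Y n := (apow o y n).

(** The idempotent [d] is orthogonal to [y] on its right and to [x] on its left,
    so the inner factor [d X_j Y_k d] of a product of two such elements is [d] or
    [0]. *)
Definition matrix_unit (p : nat * nat) : A := Y p.1 ** d ** X p.2.
Local Notation E i j := (matrix_unit (i, j)).

Lemma defect_y : d ** y = 0.
Proof. by rewrite amulBl -amulA (tt_xy oxy) (tt_oy oxy) (tt_yo oxy) subrr. Qed.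

Lemma x_defect : x ** d = 0.
Proof. by rewrite amulBr amulA (tt_xy oxy) (tt_ox oxy) (tt_xo oxy) subrr. Qed.

Lemma defect_o : d ** o = d.
Proof. by rewrite amulBl -amulA (tt_oo oxy) (tt_xo oxy). Qed.

Lemma o_defect : o ** d = d.
Proof. by rewrite amulBr amulA (tt_oo oxy) (tt_oy oxy). Qed.

Lemma defectM : d ** d = d.
Proof. by rewrite [LHS]amulBr amulA defect_y amul0l subr0 defect_o. Qed.

Lemma o_apow z n : o ** z = z -> o ** apow o z n = apow o z n.
Proof. by move=> oz; case: n => [|n] /=; rewrite ?(tt_oo oxy) ?amulA ?oz. Qed.

Lemma apow_o z n : apow o z n ** o = apow o z n.
Proof. by elim: n => [|n IHn] /=; rewrite ?(tt_oo oxy) // -amulA IHn. Qed.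

Lemma apowSr z n : o ** z = z -> z ** o = z ->
  apow o z n ** z = apow o z n.+1.
Proof. by move=> oz zo; elim: n => [|n IHn] /=; rewrite ?oz // -amulA IHn. Qed.

Lemma X_succ n : X n ** x = X n.+1.
Proof. exact: apowSr (tt_ox oxy) (tt_xo oxy). Qed.

Lemma defect_XY j k : d ** X j ** Y k ** d = if j == k then d else 0.
Proof.
elim: j k => [|j IHj] [|k] /=.
- by rewrite defect_o -amulA o_defect defectM.
- by rewrite defect_o amulA defect_y !amul0l.
- rewrite -[x ** apow _ _ _]/(X j.+1) -X_succ -!amulA.
  by rewrite o_defect x_defect !amul0r.
- rewrite eqSS -IHj -[x ** apow _ _ _]/(X j.+1) -X_succ -!amulA.
  by rewrite [x ** _]amulA (tt_xy oxy) [o ** _]amulA (o_apow _ (tt_oy oxy)).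
Qed.

Lemma matrix_unitM p q :
  matrix_unit p ** matrix_unit q = mlift matrix_unit (unit_mul F p q).
Proof.
case: p q => [i j] [k l]; rewrite /unit_mul /matrix_unit /=.
have -> : Y i ** d ** X j ** (Y k ** d ** X l)
    = Y i ** (d ** X j ** Y k ** d) ** X l by rewrite !amulA.
rewrite defect_XY; case: eqP => _; first by rewrite mliftU.
by rewrite linear0 amul0r amul0l.
Qed.

Lemma matrix_unit_o i j : E i j ** o = E i j.
Proof. by rewrite /matrix_unit -amulA apow_o. Qed.

Lemma o_matrix_unit i j : o ** E i j = E i j.
Proof. by rewrite /matrix_unit !amulA (o_apow _ (tt_oy oxy)). Qed.

Lemma y_matrix_unit i j : y ** E i j = E i.+1 j.
Proof. by rewrite /matrix_unit !amulA. Qed.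

Lemma x_matrix_unit i j : x ** E i j = if i is i'.+1 then E i' j else 0.
Proof.
rewrite /matrix_unit !amulA; case: i => [|i] /=.
  by rewrite (tt_xo oxy) x_defect amul0l.
by rewrite amulA (tt_xy oxy) (o_apow _ (tt_oy oxy)).
Qed.

Lemma matrix_unit_x i j : E i j ** x = E i j.+1.
Proof. by rewrite /matrix_unit -amulA X_succ. Qed.

Lemma matrix_unit_y i j : E i j ** y = if j is j'.+1 then E i j' else 0.
Proof.
rewrite /matrix_unit; case: j => [|j] /=.
  by rewrite -!amulA (tt_oy oxy) defect_y amul0r.
by rewrite -[x ** apow _ _ _]/(X j.+1) -X_succ -!amulA (tt_xy oxy) apow_o.
Qed.

Definition matrix_map : M_inf F -> A := mlift matrix_unit.

Lemma matrix_map_hom : alg_hom matrix_map.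
Proof.
split=> [|f g]; first exact: mlift_linear.
rewrite /matrix_map; move: f g.
apply: malg_ind => [g|a f f' IHf IHf' g|p].
- by rewrite amul0l linear0 amul0l.
- rewrite amulDl amulZl !mlift_linear amulDl amulZl.
  by congr (a *: _ + _); [apply: IHf|apply: IHf'].
apply: malg_ind => [|a g g' IHg IHg'|q].
- by rewrite amul0r linear0 amul0r.
- rewrite amulDr amulZr !mlift_linear amulDr amulZr.
  by congr (a *: _ + _); [apply: IHg|apply: IHg'].
by rewrite !mliftU matrix_unitM -[_ ** _]/(sc_mul _ _ _) sc_mulUU.
Qed.

Lemma matrix_mapU p : matrix_map << p >> = matrix_unit p.
Proof. exact: mliftU. Qed.

End OneSidedInverse.

Lemma corner_inverse (F : fieldType) (A : assocAlgType F) (o p a b : A) :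
    (forall z, o ** z = z) -> (forall z, z ** o = z) ->
    p ** p = p -> a ** p = a -> p ** b = b -> a ** b = p ->
  (a + (o - p)) ** (b + (o - p)) = o.
Proof.
move=> ol or pp ap pb ab.
have ad : a ** (o - p) = 0 by rewrite amulBr or ap subrr.
have db : (o - p) ** b = 0 by rewrite amulBl ol pb subrr.
have dd : (o - p) ** (o - p) = o - p.
  by rewrite amulBl ol amulBr or pp subrr subr0.
rewrite amulDl (amulDr a) (amulDr (o - p)) ab ad db dd addr0 add0r.
by rewrite addrC subrK.
Qed.

Lemma unitUM (F : fieldType) i j (f : M_inf F) k l :
  ((<< (i, j) >> : M_inf F) ** f)@_(k, l) = f@_(j, l) *+ (i == k).
Proof.
move: f; apply: malg_ind => [|a f g IHf IHg|[m n]].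
- by rewrite amul0r !mcoeff0 mul0rn.
- rewrite amulDr amulZr !mcoeffD !mcoeffZ mulrnDl -mulrnAr.
  by congr (a * _ + _); [apply: IHf|apply: IHg].
rewrite -[_ ** _]/(sc_mul _ _ _) sc_mulUU /unit_mul /=.
case: (j =P m) => [->|/eqP jm]; rewrite ?mcoeff0 ?mcoeffU !xpair_eqE.
  by rewrite eqxx -mulrnA mulnb andbC.
by rewrite [m == j]eq_sym (negbTE jm) mul0rn.
Qed.

Lemma unitMU (F : fieldType) i j (f : M_inf F) k l :
  (f ** (<< (i, j) >> : M_inf F))@_(k, l) = f@_(k, i) *+ (j == l).
Proof.
move: f; apply: malg_ind => [|a f g IHf IHg|[m n]].
- by rewrite amul0l !mcoeff0 mul0rn.
- rewrite amulDl amulZl !mcoeffD !mcoeffZ mulrnDl -mulrnAr.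
  by congr (a * _ + _); [apply: IHf|apply: IHg].
rewrite -[_ ** _]/(sc_mul _ _ _) sc_mulUU /unit_mul /=.
case: (n =P i) => [->|/eqP ni]; rewrite ?mcoeff0 ?mcoeffU !xpair_eqE.
  by rewrite eqxx andbT -mulrnA mulnb.
by rewrite (negbTE ni) andbF mul0rn.
Qed.

(** Isolates one entry of a matrix by multiplications, so that the kernel of an
    algebra morphism can be tested entry by entry. *)
Lemma unit_corner (F : fieldType) i j (f : M_inf F) :
  (<< (0, i) >> : M_inf F) ** f ** (<< (j, 0) >> : M_inf F)
    = f@_(i, j) *: << (0, 0) >>.
Proof.
apply/malgP => -[k l]; rewrite unitMU unitUM mcoeffZ mcoeffU xpair_eqE.
by rewrite mulrnAr mulr1 -mulrnA mulnb.
Qed.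

(** The kernel contains, with [f], the corner [f_ij E_00] for all [i] and [j];
    but [E_00] is mapped to the nonzero vector [o - y x]. *)
Lemma matrix_map_inj (F : fieldType) (A : assocAlgType F) (o x y : A) :
  toeplitz_triple o x y -> o - y ** x != 0 -> injective (matrix_map o x y).
Proof.
move=> oxy d0; have mh := matrix_map_hom oxy.
suff inj0 f : matrix_map o x y f = 0 -> f = 0.
  move=> f g fg; apply/eqP; rewrite -subr_eq0; apply/eqP/inj0.
  by rewrite (alg_homB mh) fg subrr.
move=> mf; apply/malgP => -[i j]; rewrite mcoeff0.
have := congr1 (matrix_map o x y) (unit_corner i j f).
rewrite !mh.2 mf amul0r amul0l (alg_homZ _ _ mh) matrix_mapU.
rewrite /matrix_unit /= (o_defect oxy) (defect_o oxy) => /esym/eqP.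
by rewrite scaler_eq0 (negbTE d0) orbF => /eqP.
Qed.

(** * The Toeplitz algebra as a universal one-sided inverse *)

Section ToeplitzUniversal.
Context (F : fieldType).
Local Notation L := (toeplitz F).
Definition toep_one : L := toep_v1 F + toep_v2 F.
Definition toep_shift : L := toep_c F + toep_e F.
Definition toep_shift_star : L := toep_c_star F + toep_e_star F.
Local Notation o := toep_one.
Local Notation S := toep_shift.
Local Notation S' := toep_shift_star.

(* The generators as families indexed by the booleans that encode the vertices
   and the edges, so that one rewrite rule serves both values. *)
Let V (b : bool) : L := @lpa_vert F toeplitz_graph b.
Let E (b : bool) : L := @lpa_edge F toeplitz_graph b.
Let G (b : bool) : L := @lpa_ghost F toeplitz_graph b.

Let oE : o = V false + V true. Proof. by []. Qed.
Let SE : S = E false + E true. Proof. by []. Qed.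
Let S'E : S' = G false + G true. Proof. by []. Qed.

Let VM a b : V a ** V b = if a == b then V a else 0.
Proof. exact: (@lpa_vertM F toeplitz_graph). Qed.

Let EV a b : E a ** V b = if a == b then E a else 0.
Proof.
have EVa : E a ** V a = E a by exact: (@lpa_edge_rngE F toeplitz_graph).
by rewrite -EVa -amulA VM; case: ifP => _; rewrite ?amul0r.
Qed.

Let VG a b : V a ** G b = if a == b then G b else 0.
Proof.
have VGb : V b ** G b = G b by exact: (@lpa_rng_ghostE F toeplitz_graph).
by rewrite -VGb amulA VM; case: eqP => [->|_]; rewrite ?amul0l.
Qed.

Let VE a b : V a ** E b = if a then 0 else E b.
Proof.
have VEb : V false ** E b = E b by exact: (@lpa_src_edgeE F toeplitz_graph).
by rewrite -VEb amulA VM; case: a; rewrite ?amul0l.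
Qed.

Let GV a b : G a ** V b = if b then 0 else G a.
Proof.
have GVa : G a ** V false = G a by exact: (@lpa_ghost_srcE F toeplitz_graph).
by rewrite -GVa -amulA VM; case: b; rewrite ?amul0r.
Qed.

Let GE a b : G a ** E b = if a == b then V a else 0.
Proof. exact: (@lpa_ghost_edgeE F toeplitz_graph). Qed.

Let EG a b : a != b -> E a ** G b = 0.
Proof.
move=> /negbTE ab; have := EV a a; rewrite eqxx => <-.
by rewrite -amulA VG ab amul0r.
Qed.

Let toep_shiftM_star : S ** S' = V false.
Proof.
rewrite SE S'E amulDl !amulDr (EG (isT : false != true)).
rewrite (EG (isT : true != false)) addr0 add0r.
rewrite [RHS](@lpa_CKE F toeplitz_graph false); last by exists false.
by rewrite big_bool addrC.
Qed.

Lemma toeplitz_shift_triple : toeplitz_triple o S' S.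
Proof.
split; rewrite ?SE ?S'E ?oE amulDl !amulDr !(VM, EV, VE, VG, GV, GE) /=.
all: by rewrite ?addr0 ?add0r.
Qed.

Lemma toep_defect : o - S ** S' = toep_v2 F.
Proof. by rewrite toep_shiftM_star oE addrC addrA addNr add0r. Qed.

(** The vertices are [S S'] and [o - S S'], and multiplying [S] and [S'] by a
    vertex isolates the edges and the ghost edges. *)
Lemma toeplitz_ind (P : L -> Prop) :
    P o -> P S -> P S' ->
    (forall a x y, P x -> P y -> P (a *: x + y)) ->
    (forall x y, P x -> P y -> P (x ** y)) ->
  forall x, P x.
Proof.
move=> Po PS PS' Plin PM.
have P0 : P 0 by rewrite -(addNr o) -scaleN1r; apply: Plin.
have PV b : P (V b).
  have PSS' : P (S ** S') by apply: PM.
  case: b; last by rewrite -toep_shiftM_star.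
  by rewrite -[V true]toep_defect addrC -scaleN1r; apply: Plin.
apply: pres_ind => // -[b|b|b]; first exact: PV.
- suff SV : S ** V b = E b by rewrite -[pres_gen _ _]/(E b) -SV; apply: PM.
  by rewrite SE amulDl !EV; case: b; rewrite /= ?add0r ?addr0.
- suff VS : V b ** S' = G b by rewrite -[pres_gen _ _]/(G b) -VS; apply: PM.
  by rewrite S'E amulDr !VG; case: b; rewrite /= ?add0r ?addr0.
Qed.

Lemma toep_oneP z : o ** z = z /\ z ** o = z.
Proof.
have oxy := toeplitz_shift_triple.
move: z; apply: toeplitz_ind => [|||a z w [oz zo] [ow wo]|z w [oz _] [_ wo]].
- by rewrite (tt_oo oxy).
- by rewrite (tt_oy oxy) (tt_yo oxy).
- by rewrite (tt_ox oxy) (tt_xo oxy).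
- by split; [rewrite amulDr amulZr oz ow|rewrite amulDl amulZl zo wo].
by rewrite amulA oz -amulA wo.
Qed.

(** Conversely any triple in [A] is the image of [(o, S', S)]. The edge and the
    ghost edge attached to [v] as range are [y] and [x] cut down by the
    idempotent [p v]. *)
Section Lift.
Context (A : assocAlgType F) (a x y : A).
Hypothesis oxy : toeplitz_triple a x y.

Let p (v : bool) := if v then a - y ** x else y ** x.

Let pp v w : p v ** p w = if v == w then p v else 0.
Proof.
have yxyx : y ** x ** (y ** x) = y ** x.
  by rewrite amulA -(amulA y) (tt_xy oxy) (tt_yo oxy).
case: v w => [] [] //=; first exact: defectM.
  by rewrite amulBl yxyx amulA (tt_oy oxy) subrr.
by rewrite amulBr yxyx -amulA (tt_xo oxy) subrr.
Qed.

Let ap v : a ** p v = p v.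
Proof. by case: v; rewrite /= ?(o_defect oxy) // amulA (tt_oy oxy). Qed.

Definition toep_gen_image (g : lpa_gen toeplitz_graph) : A :=
  match g with
  | Vert v => p v
  | Edge f => y ** p f
  | Ghost f => p f ** x
  end.

Lemma toep_gen_image_rel s t : @lpa_rel F toeplitz_graph s t ->
  teval toep_gen_image s = teval toep_gen_image t.
Proof.
case=> {s t} /= [v w|f|f|f|f|f g|v [f <-]].
- by rewrite pp; case: eqP.
- by rewrite -[y ** x ** _]amulA [x ** _]amulA (tt_xy oxy) ap.
- by rewrite -amulA pp eqxx.
- by rewrite amulA pp eqxx.
- by rewrite -[_ ** x ** _]amulA [x ** _]amulA (tt_xy oxy) (tt_ox oxy).
- rewrite -[_ ** x ** _]amulA [x ** _]amulA (tt_xy oxy) ap pp.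
  by case: eqP.
rewrite (big_morph (teval toep_gen_image) (id1 := 0) (op1 := +%R)) //.
under eq_bigr do rewrite /= amulA -[y ** _ ** _]amulA pp eqxx.
by rewrite big_bool /= -amulDl -amulDr /p addrNK (tt_yo oxy).
Qed.

Definition toeplitz_lift : L -> A := pres_lift toep_gen_image (R := _).

Lemma toeplitz_lift_hom : alg_hom toeplitz_lift.
Proof. exact: pres_lift_hom toep_gen_image_rel. Qed.

Let liftE g : toeplitz_lift (pres_gen _ g) = toep_gen_image g.
Proof. exact: pres_lift_gen toep_gen_image_rel _. Qed.

Lemma toeplitz_lift_one : toeplitz_lift o = a.
Proof.
by rewrite (alg_homD toeplitz_lift_hom) !liftE /= addrC addrNK.
Qed.

Lemma toeplitz_lift_v2 : toeplitz_lift (toep_v2 F) = a - y ** x.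
Proof. exact: liftE. Qed.

Lemma toeplitz_lift_c : toeplitz_lift (toep_c F) = y ** (y ** x).
Proof. exact: liftE. Qed.

Lemma toeplitz_lift_c_star : toeplitz_lift (toep_c_star F) = y ** x ** x.
Proof. exact: liftE. Qed.

Lemma toeplitz_lift_shift : toeplitz_lift S = y.
Proof.
rewrite (alg_homD toeplitz_lift_hom) !liftE /= -amulDr addrC addrNK.
exact: tt_yo oxy.
Qed.

Lemma toeplitz_lift_shift_star : toeplitz_lift S' = x.
Proof.
rewrite (alg_homD toeplitz_lift_hom) !liftE /= -amulDl addrC addrNK.
exact: tt_ox oxy.
Qed.

End Lift.

End ToeplitzUniversal.

(** The algebra of the bicyclic monoid: [<< (i, j) >>] is the normal form
    [y^i x^j], and [x^j y^k] cancels down to [x^(j - k)] or [y^(k - j)]. The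
    truncated subtractions express both cases at once. *)
Section Bicyclic.
Context (F : fieldType).

Definition bicyclic := {malg F[(nat * nat)%type]}.
HB.instance Definition _ := GRing.Lmodule.on bicyclic.

Definition bicyclic_mul (p q : nat * nat) : bicyclic :=
  << ((p.1 + (q.1 - p.2))%N, (q.2 + (p.2 - q.1))%N) >>.

Lemma bicyclic_mulA p q r :
  sc_mul bicyclic_mul (bicyclic_mul p q) << r >> =
  sc_mul bicyclic_mul << p >> (bicyclic_mul q r).
Proof.
rewrite !sc_mulUU /bicyclic_mul /=; congr (<< (_, _) >>); lia.
Qed.

HB.instance Definition _ := Lmodule_isAssocAlgebra.Build F bicyclic
  (sc_mulA bicyclic_mulA) (@sc_mulDl _ _ bicyclic_mul)
  (@sc_mulDr _ _ bicyclic_mul) (@sc_mulZl _ _ bicyclic_mul)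
  (@sc_mulZr _ _ bicyclic_mul).

Lemma bicyclicUU p q :
  (<< p >> : bicyclic) ** (<< q >> : bicyclic) = bicyclic_mul p q.
Proof. by rewrite -[_ ** _]/(sc_mul _ _ _) sc_mulUU. Qed.

Lemma bicyclic_triple : toeplitz_triple
  (<< (0, 0)%N >> : bicyclic) (<< (0, 1)%N >> : bicyclic)
  (<< (1, 0)%N >> : bicyclic).
Proof. by split; rewrite bicyclicUU. Qed.

Lemma toep_v2_neq0 : toep_v2 F != 0.
Proof.
apply/eqP => v20; have := toeplitz_lift_v2 bicyclic_triple.
rewrite v20 (alg_hom0 (toeplitz_lift_hom bicyclic_triple)) bicyclicUU.
move=> /(congr1 (mcoeff (0, 0)%N)); rewrite mcoeff0 mcoeffB !mcoeffU /=.
by rewrite subr0 => /esym/eqP; rewrite oner_eq0.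
Qed.

End Bicyclic.

(** * The extension by Laurent polynomials *)

Section Extension.
Context (F : fieldType).
Local Notation L := (toeplitz F).
Local Notation o := (toep_one F).
Local Notation S := (toep_shift F).
Local Notation S' := (toep_shift_star F).

Lemma laurentUU (i j : int) :
  (<< i >> : laurent F) ** (<< j >> : laurent F) = << (i + j)%R >>.
Proof. by rewrite -[_ ** _]/(sc_mul _ _ _) sc_mulUU. Qed.

Lemma laurent_triple :
  toeplitz_triple (<< 0%Z >> : laurent F) (laurent_tV F) (laurent_t F).
Proof. by split; rewrite laurentUU. Qed.

Definition toep_iota : M_inf F -> L := matrix_map o S' S.
Definition toep_pi : L -> laurent F :=
  toeplitz_lift (<< 0%Z >> : laurent F) (laurent_tV F) (laurent_t F).

Let oxy := toeplitz_shift_triple F.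

Lemma toep_iota_hom : alg_hom toep_iota.
Proof. exact: matrix_map_hom. Qed.

Lemma toep_pi_hom : alg_hom toep_pi.
Proof. exact: toeplitz_lift_hom laurent_triple. Qed.

Lemma toep_iota_inj : injective toep_iota.
Proof. by apply: matrix_map_inj => //; rewrite toep_defect toep_v2_neq0. Qed.

Definition toep_matrix (z : L) := exists f, toep_iota f = z.
Local Notation im := toep_matrix.

Lemma toep_matrix0 : im 0.
Proof. by exists 0; exact: alg_hom0 toep_iota_hom. Qed.

Lemma toep_matrix_lin a z w : im z -> im w -> im (a *: z + w).
Proof. by case=> f <- [g <-]; exists (a *: f + g); rewrite toep_iota_hom.1. Qed.

Lemma toep_matrix_unit i j : im (matrix_unit o S' S (i, j)).
Proof. by exists << (i, j) >>; apply: matrix_mapU. Qed.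

(** Multiplication by [S] or [S'] moves the index of a matrix unit by one, and
    these generate the algebra. *)
Lemma toep_iota_ideal : two_sided_ideal im.
Proof.
suff imM w f : im (w ** toep_iota f) /\ im (toep_iota f ** w).
  split; [exact: toep_matrix0|exact: toep_matrix_lin| |].
    by move=> w _ [f <-]; have [] := imM w f.
  by move=> w _ [f <-]; have [] := imM w f.
have extend z :
    (forall i j, im (z ** matrix_unit o S' S (i, j)) /\
                 im (matrix_unit o S' S (i, j) ** z)) ->
  forall f, im (z ** toep_iota f) /\ im (toep_iota f ** z).
  move=> imU; apply: malg_ind => [|a g h [? ?] [? ?]|[i j]].
  - rewrite (alg_hom0 toep_iota_hom) amul0l amul0r.
    by split; apply: toep_matrix0.
  - rewrite toep_iota_hom.1 amulDl amulDr amulZl amulZr.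
    by split; apply: toep_matrix_lin.
  by rewrite /toep_iota matrix_mapU.
move: w f; apply: toeplitz_ind => [|||a z w imz imw f|z w imz imw f].
- apply: extend => i j; rewrite (o_matrix_unit oxy) (matrix_unit_o oxy).
  by split; apply: toep_matrix_unit.
- apply: extend => i j; rewrite y_matrix_unit (matrix_unit_y oxy).
  split; first exact: toep_matrix_unit.
  by case: j => [|j]; [apply: toep_matrix0|apply: toep_matrix_unit].
- apply: extend => i j; rewrite (x_matrix_unit oxy) (matrix_unit_x oxy).
  split; last exact: toep_matrix_unit.
  by case: i => [|i]; [apply: toep_matrix0|apply: toep_matrix_unit].
- rewrite amulDl amulDr amulZl amulZr.
  by have [[? ?] [? ?]] := (imz f, imw f); split; apply: toep_matrix_lin.
split; [rewrite -amulA; have [[g <-] _] := imw f|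
        rewrite amulA; have [_ [g <-]] := imz f].
  by have [] := imz g.
by have [] := imw g.
Qed.

Lemma toep_iota_v2 : toep_iota << (0, 0)%N >> = toep_v2 F.
Proof.
rewrite /toep_iota matrix_mapU /matrix_unit /= (o_defect oxy) (defect_o oxy).
exact: toep_defect.
Qed.

Lemma toep_I0E z : toep_I0 z <-> exists f, toep_iota f = z.
Proof.
split=> [I0z|[f <-] I [I0 Ilin Il Ir] /(_ _ erefl) Iv2].
  apply: (I0z im toep_iota_ideal).
  by move=> _ ->; exists << (0, 0)%N >>; apply: toep_iota_v2.
move: f; apply: malg_ind => [|a f g If Ig|[i j]].
- by rewrite (alg_hom0 toep_iota_hom).
- by rewrite toep_iota_hom.1; apply: Ilin.
by rewrite /toep_iota matrix_mapU /matrix_unit toep_defect; apply/Ir/Il.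
Qed.

Lemma toep_pi_iota f : toep_pi (toep_iota f) = 0.
Proof.
have /toep_I0E : exists g, toep_iota g = toep_iota f by exists f.
move/(_ (fun z => toep_pi z = 0)); apply=> [|_ ->]; last first.
  rewrite /toep_pi (toeplitz_lift_v2 laurent_triple) laurentUU.
  exact: subrr.
split=> [|a z w pz pw|a z pz|a z pz]; first exact: alg_hom0 toep_pi_hom.
- by rewrite toep_pi_hom.1 pz pw scaler0 addr0.
- by rewrite toep_pi_hom.2 pz amul0r.
- by rewrite toep_pi_hom.2 pz amul0l.
Qed.

Definition laurent_monomial_lift (n : int) : L :=
  match n with Posz m => apow o S m | Negz m => apow o S' m.+1 end.

Definition laurent_section : laurent F -> L := mlift laurent_monomial_lift.
Local Notation s := laurent_section.

Lemma laurent_sectionK : cancel laurent_section toep_pi.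
Proof.
have apowE (z : laurent F) n (k : int) : z = << k >> ->
    apow (<< 0%Z >> : laurent F) z n = << k *+ n >>.
  by move=> ->; elim: n => //= n ->; rewrite laurentUU mulrS.
have pi_apow z n :
    toep_pi (apow o z n) = apow (<< 0%Z >> : laurent F) (toep_pi z) n.
  elim: n => [|n IHn] /=; first exact: toeplitz_lift_one laurent_triple.
  by rewrite toep_pi_hom.2 IHn.
apply: malg_ind => [|a f g IHf IHg|n].
- by rewrite /s linear0 (alg_hom0 toep_pi_hom).
- by rewrite /s mlift_linear toep_pi_hom.1 IHf IHg.
rewrite /s mliftU; case: n => n; rewrite pi_apow.
  rewrite (apowE _ _ 1); last exact: toeplitz_lift_shift laurent_triple.
  by rewrite -[1 *+ n]/(n%:R) natz.
rewrite (apowE _ _ (-1)); last exact: toeplitz_lift_shift_star laurent_triple.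
by rewrite mulNrn NegzE -[1 *+ _]/(_%:R) natz.
Qed.

(** The linear section of the projection is multiplicative modulo the matrices.
    Among the generators [z] and the monomials [f], the two sides only differ
    for [z = S] and [f = t^-n] with [n > 0], where the difference is
    [- v2 S'^(n - 1)]. *)
Lemma laurent_section_act z f : im (z ** s f - s (toep_pi z ** f)).
Proof.
have im_eq u w : u = w -> im (u - w).
  by move=> ->; rewrite subrr; exact: toep_matrix0.
have extend w :
    (forall n, im (w ** s << n >> - s (toep_pi w ** << n >>))) ->
  forall g, im (w ** s g - s (toep_pi w ** g)).
  move=> imU; apply: malg_ind => [|a g h img imh|//].
    by apply: im_eq; rewrite amul0r /s linear0 amul0r.
  rewrite amulDr amulZr /s !mlift_linear amulDr amulZr opprD addrACA -scalerBr.
  exact: toep_matrix_lin img imh.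
move: z f; apply: toeplitz_ind => [|||a z w imz imw f|z w imz imw f].
- apply: extend => n; rewrite /toep_pi (toeplitz_lift_one laurent_triple).
  rewrite laurentUU add0r /s mliftU; apply: im_eq.
  by case: n => n; rewrite /= ?(o_apow oxy _ (tt_oy oxy)) // amulA (tt_ox oxy).
- apply: extend => n; rewrite /toep_pi (toeplitz_lift_shift laurent_triple).
  rewrite laurentUU /s !mliftU; case: n => n.
    by apply: im_eq; rewrite -PoszD add1n.
  have -> : 1 + Negz n = - n%:Z by lia.
  have -> : laurent_monomial_lift (- n%:Z) = apow o S' n by case: n.
  rewrite [S ** _]amulA -[X in _ - X](o_apow oxy n (tt_ox oxy)) -amulBl.
  rewrite -opprB toep_defect -scaleN1r amulZl -[_ *: _]addr0.
  apply: toep_matrix_lin toep_matrix0; apply: (Defs.idealMr toep_iota_ideal).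
  by exists << (0, 0)%N >>; apply: toep_iota_v2.
- apply: extend => n.
  rewrite /toep_pi (toeplitz_lift_shift_star laurent_triple) laurentUU.
  rewrite /s !mliftU; case: n => n; last first.
    have -> : (- 1%:Z) + Negz n = Negz n.+1 by lia.
    exact: im_eq.
  apply: im_eq; case: n => [|n] //.
  rewrite [LHS]amulA (tt_xy oxy) [LHS](o_apow oxy n (tt_oy oxy)).
  by have -> : (- 1%:Z) + n.+1 = n by lia.
- rewrite toep_pi_hom.1 !amulDl !amulZl /s mlift_linear opprD addrACA -scalerBr.
  exact: toep_matrix_lin (imz f) (imw f).
rewrite -amulA toep_pi_hom.2 -amulA.
rewrite -(subrK (z ** s (toep_pi w ** f)) (z ** _)) -addrA -amulBr.
rewrite -[X in im (X + _)]scale1r; apply: toep_matrix_lin; last exact: imz.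
exact: Defs.idealMl toep_iota_ideal _ _ (imw f).
Qed.

Lemma toep_pi_kernel z : toep_pi z = 0 -> exists f, toep_iota f = z.
Proof.
move=> pz; have := laurent_section_act z << 0%Z >>.
by rewrite pz amul0l /s linear0 subr0 mliftU [z ** _](toep_oneP z).2.
Qed.

Lemma toeplitz_extension_iota_pi : toeplitz_extension toep_iota toep_pi.
Proof.
split.
- split; [exact: toep_iota_hom|exact: toep_pi_hom|exact: toep_iota_inj| |].
    by move=> f; exists (s f); apply: laurent_sectionK.
  move=> z; split=> [|[f <-]]; [exact: toep_pi_kernel|exact: toep_pi_iota].
- exact: toep_I0E.
- by rewrite /toep_pi (toeplitz_lift_c laurent_triple) !laurentUU.
- by rewrite /toep_pi (toeplitz_lift_c_star laurent_triple) !laurentUU.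
Qed.

End Extension.

(** * The shift modulo matrices is not invertible *)

Lemma exists_left_kernel (F : fieldType) n (M : 'M[F]_(n.+1, n)) :
  exists2 v : 'rV[F]_n.+1, v != 0 & v *m M = 0.
Proof.
have /rowV0Pn [v /sub_kermxP vM v0] : kermx M != 0.
  by rewrite -mxrank_eq0 mxrank_ker subn_eq0 -ltnNge ltnS rank_leq_col.
by exists v.
Qed.

Lemma M_inf_cols_bounded (F : fieldType) (f : M_inf F) :
  exists n, forall i j, (n <= j)%N -> f@_(i, j) = 0.
Proof.
exists (\max_(p <- msupp f) p.2.+1) => i j nj; apply: mcoeff_outdom.
apply: contraL nj => fij; rewrite -ltnNge.
exact: (leq_bigmax_seq (F := fun p : nat * nat => p.2.+1) (i, j) fij).
Qed.

Section ShiftPerturbation.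
Context (F : fieldType).
Local Notation L := (toeplitz F).
Local Notation o := (toep_one F).
Local Notation S := (toep_shift F).
Local Notation S' := (toep_shift_star F).
Let iotah := toep_iota_hom F.
Let oxy := toeplitz_shift_triple F.

(** Row vectors of length [n.+1] are matrices supported on the first row; the
    product with [S + f] has its support in the first [n] columns, where [n]
    bounds the columns of [f]. *)
Lemma shift_perturbation_annihilated (f : M_inf F) :
  exists2 g : M_inf F, g != 0 & toep_iota g ** (S + toep_iota f) = 0.
Proof.
have [n fn] := M_inf_cols_bounded f.
pose row m (w : nat -> F) : M_inf F := \sum_(j < m) w j *: << (0%N, j : nat) >>.
have rowE m w i k : (row m w)@_(i, k) = (w k) *+ ((i == 0%N) && (k < m)%N).
  rewrite raddf_sum /=; case: ltnP => km; rewrite ?andbT ?andbF.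
    rewrite (bigD1 (Ordinal km)) //= big1 => [|j jk];
      rewrite mcoeffZ mcoeffU xpair_eqE /=.
      by rewrite eqxx andbT addr0 mulrnAr mulr1 eq_sym.
    by rewrite -[(j : nat) == k]/(j == Ordinal km) (negbTE jk) andbF mulr0.
  rewrite big1 // => j _; rewrite mcoeffZ mcoeffU xpair_eqE.
  by rewrite (ltn_eqF (leq_trans (ltn_ord j) km)) andbF mulr0.
have iota_row m w : toep_iota (row m w)
    = \sum_(j < m) w j *: matrix_unit o S' S (0%N, j : nat).
  rewrite (alg_hom_sum _ _ _ iotah); apply: eq_bigr => j _.
  by rewrite (alg_homZ _ _ iotah) /toep_iota matrix_mapU.
have row_shift m w :
    toep_iota (row m.+1 w) ** S = toep_iota (row m (w \o succn)).
  rewrite !iota_row amul_suml big_ord_recl amulZl (matrix_unit_y oxy).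
  rewrite scaler0 add0r; apply: eq_bigr => j _.
  by rewrite amulZl (matrix_unit_y oxy).
(* The matrix of w |-> w (S + f), from rows of length n + 1 to length n. *)
pose M : 'M[F]_(n.+1, n) :=
  \matrix_(j, k) ((j == k.+1 :> nat)%:R + f@_(j : nat, k : nat)).
have [v v0 vM] := exists_left_kernel M.
pose w j := v 0 (inord j).
exists (row n.+1 w).
  apply: contra_neq v0 => r0; apply/rowP => j; rewrite mxE.
  have := rowE n.+1 w 0%N j; rewrite r0 mcoeff0 ltn_ord eqxx => ->.
  by rewrite /w inord_val.
rewrite amulDr row_shift -iotah.2 -(alg_homD iotah).
suff -> : row n (w \o succn) + row n.+1 w ** f = 0.
  exact: alg_hom0 iotah.
apply/malgP => -[i k]; rewrite mcoeff0 mcoeffD rowE.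
have -> : (row n.+1 w ** f)@_(i, k)
    = \sum_(j < n.+1) v 0 j * f@_(j : nat, k) *+ (i == 0%N).
  rewrite (@amul_suml F (M_inf F)) raddf_sum; apply: eq_bigr => j _ /=.
  rewrite (@amulZl F (M_inf F)).
  by rewrite mcoeffZ unitUM /w inord_val mulrnAr eq_sym.
case: eqP => [_|_]; last by rewrite add0r big1.
case: ltnP => /= kn; last first.
  by rewrite add0r big1 // => j _; rewrite fn ?mulr0.
have /rowP /(_ (Ordinal kn)) := vM; rewrite !mxE => vMk.
rewrite -[RHS]vMk.
under [RHS]eq_bigr do rewrite mxE /= mulrDr.
rewrite big_split /=; congr (_ + _).
rewrite (bigD1 (inord k.+1)) //= inordK ?ltnS // eqxx mulr1 big1 ?addr0 //.
move=> j jk; case: eqP => [jk1|]; last by rewrite mulr0.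
by move: jk; rewrite -jk1 inord_val eqxx.
Qed.

Lemma shift_perturbation_not_right_invertible (f : M_inf F) (z : L) :
  (S + toep_iota f) ** z <> o.
Proof.
have [g /eqP g0 gS] := shift_perturbation_annihilated f; move=> Sz; apply: g0.
apply: (@toep_iota_inj F).
by rewrite (alg_hom0 iotah) -[LHS](toep_oneP _).2 -Sz amulA gS amul0l.
Qed.

End ShiftPerturbation.

(** The element [sigma t] is only invertible in the corner cut out by the
    idempotent [sigma 1]. Adding [o - sigma 1] makes it invertible in the whole
    Toeplitz algebra and does not change its image, since [pi o = 1]. *)
Lemma toeplitz_extension_not_split (F : fieldType) iota pi :
  @toeplitz_extension F iota pi -> ~ splits pi.
Proof.
move=> [[_ pih _ _ kerE] I0E pic pics] [sigma sh sK].
set o := toep_one F; set S := toep_shift F.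
have oL z : o ** z = z := (toep_oneP z).1.
have Lo z : z ** o = z := (toep_oneP z).2.
set p := sigma << 0%Z >>; set a := sigma (laurent_t F).
set b := sigma (laurent_tV F).
have unit_lift : (a + (o - p)) ** (b + (o - p)) = o.
  by apply: corner_inverse => //; rewrite -sh.2 laurentUU.
have pi_v2 : pi (toep_v2 F) = 0.
  apply/kerE/I0E; rewrite toep_I0E; exists << (0, 0)%N >>.
  exact: toep_iota_v2.
have pi_v1 : pi (toep_v1 F) = << 0%Z >>.
  have <- : toep_c_star F ** toep_c F = toep_v1 F.
    exact: (@lpa_ghost_edgeE F toeplitz_graph false false).
  by rewrite pih.2 pic pics laurentUU.
have pi_e : pi (toep_e F) = 0.
  have <- : toep_e F ** toep_v2 F = toep_e F.
    exact: (@lpa_edge_rngE F toeplitz_graph true).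
  by rewrite pih.2 pi_v2 amul0r.
have pi_o : pi o = << 0%Z >> by rewrite (alg_homD pih) pi_v1 pi_v2 addr0.
have pi_S : pi S = laurent_t F by rewrite (alg_homD pih) pic pi_e addr0.
have [f fE] : exists f, toep_iota f = a + (o - p) - S.
  apply/toep_I0E/I0E/kerE.
  rewrite (alg_homB pih) pi_S (alg_homD pih) (alg_homB pih) pi_o !sK.
  by rewrite subrr addr0 subrr.
apply: (@shift_perturbation_not_right_invertible F f (b + (o - p))).
by rewrite fE addrC subrK.
Qed.

Theorem theorem2 (F : fieldType) :
  (exists iota : M_inf F -> toeplitz F, exists pi : toeplitz F -> laurent F,
     toeplitz_extension iota pi) /\
  (forall (iota : M_inf F -> toeplitz F) (pi : toeplitz F -> laurent F),
     toeplitz_extension iota pi -> ~ splits pi).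
Proof.
split; last exact: toeplitz_extension_not_split.
by exists (@toep_iota F), (@toep_pi F); apply: toeplitz_extension_iota_pi.
Qed.
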